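(* Let $\kappa$ be a field and let $A,B$ be two $m\times n$ matrices over $\kappa$, viewed as linear maps $\kappa^n\to\kappa^m$. Consider the following procedure, which uses the modifications $T_1,T_2,T_3$ (defined in the context), each of which replaces a pair of matrices of equal size by another pair of matrices of equal size. (I) If $A$ is surjective go to (II); else replace $(A,B)$ by $T_1(A,B)$ and go to (I). (II) If $B$ is surjective go to (III); else replace $(A,B)$ by $T_2(A,B)$ and go to (II). (III) If $A$ is injective, stop; else replace $(A,B)$ by $T_3(A,B)$ and go to (III). Then the procedure terminates and outputs a pair $(A',B')$ of invertible $k\times k$ matrices, with $0\le k\le\min\{m,n\}$, such that $R(A,B)_{reg}\sim R(A',B')_{reg}$ for the original input $(A,B)$; that is, the linear isomorphism $T^{R(A,B)}$ is similar to $(B')^{-1}A'$.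
   Context: Linear relations. A linear relation $R:V\rightsquigarrow V$ on a finite dimensional vector space is a linear subspace $R\subseteq V\times V$; write $vRw$ for $(v,w)\in R$. For linear maps $\alpha,\beta:V\to W$ put $R(\alpha,\beta)=\{(v,v'): \alpha(v)=\beta(v')\}$. For $R:V\rightsquigarrow V$ define $D=\{v: \exists (v_i)_{i\in\mathbb Z}\text{ in }V,\ v_iRv_{i+1},\ v_0=v\}$, $K_+=\{v: \exists k\ge 0 \text{ and } v_0=v,v_1,\dots,v_k \text{ with } v_iRv_{i+1}\ (0\le i<k),\ v_kR0\}$, $K_-=\{v: \exists k\ge 0 \text{ and } v_{-k},\dots,v_0=v \text{ with } 0Rv_{-k},\ v_iRv_{i+1}\ (-k\le i<0)\}$, $V_{reg}=D/(D\cap(K_++K_-))$, and let $R_{reg}:V_{reg}\rightsquigarrow V_{reg}$ be the image of $R\cap(D\times D)$ in $V_{reg}\times V_{reg}$. It is a known fact that $R_{reg}$ is the graph of a linear isomorphism $T^R:V_{reg}\to V_{reg}$. Two relations $R:V\rightsquigarrow V$, $R':V'\rightsquigarrow V'$ are similar, $R\sim R'$, if there is a linear isomorphism $\omega:V\to V'$ with $(\omega\times\omega)(R)=R'$; for graphs of linear maps this is the usual similarity (conjugacy). Modifications. Let $A,B$ be $m\times n$ matrices (matrices with zero rows or zero columns are allowed). $T_1(A,B)$: choose an invertible $m\times m$ matrix $C$ with $CA=\begin{pmatrix} A_1 \\ 0 \end{pmatrix}$, $A_1$ of full row rank (row echelon form), and write $CB=\begin{pmatrix} B_1 \\ B_2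 \end{pmatrix}$ correspondingly; choose an invertible $n\times n$ matrix $D$ with $B_2D=\begin{pmatrix} B_{21} & 0 \end{pmatrix}$, $B_{21}$ of full column rank (column echelon form), and write correspondingly $A_1D=\begin{pmatrix} A_{11} & A_{12} \end{pmatrix}$, $B_1D=\begin{pmatrix} B_{11} & B_{12} \end{pmatrix}$. Put $T_1(A,B)=(A_{12},B_{12})$. $T_2(A,B)$: choose an invertible $m\times m$ matrix $C$ with $CB=\begin{pmatrix} B_1 \\ 0 \end{pmatrix}$, $B_1$ of full row rank, and write $CA=\begin{pmatrix} A_1 \\ A_2 \end{pmatrix}$; choose an invertible $n\times n$ matrix $D$ with $A_2D=\begin{pmatrix} A_{21} & 0 \end{pmatrix}$, $A_{21}$ of full column rank, and write $A_1D=\begin{pmatrix} A_{11} & A_{12} \end{pmatrix}$, $B_1D=\begin{pmatrix} B_{11} & B_{12} \end{pmatrix}$. Put $T_2(A,B)=(A_{12},B_{12})$. $T_3(A,B)$: choose an invertible $n\times n$ matrix $D$ with $AD=\begin{pmatrix} A_1 & 0 \end{pmatrix}$, $A_1$ of full column rank, and write $BD=\begin{pmatrix} B_1 & B_2 \end{pmatrix}$; choose an invertible $m\times m$ matrix $C$ with $CB_2=\begin{pmatrix} B_{12} \\ 0 \end{pmatrix}$, $B_{12}$ of full row rank, and write correspondingly $CA_1=\begin{pmatrix} A_{11} \\ A_{21} \end{pmatrix}$, $CB_1=\begin{pmatrix} B_{11} \\ B_{21} \end{pmatrix}$. Put $T_3(A,B)=(A_{21},B_{21})$. *)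

(* Defs.v *)
From HB Require Import structures.
From mathcomp Require Import all_boot all_order all_algebra.
From mathcomp Require Import generic_quotient ring_quotient.
From mathcomp Require Import boolp.

Set Implicit Arguments.
Unset Strict Implicit.
Unset Printing Implicit Defensive.

Import GRing.Theory.
Local Open Scope ring_scope.

Section VspaceOf.
Variables (K : fieldType) (V : vectType K).

Definition subspace (P : V -> Prop) : Prop :=
  P 0 /\ forall (a : K) (u v : V), P u -> P v -> P (a *: u + v).

Lemma vspace_of_ex (P : V -> Prop) :
  subspace P -> exists U : {vspace V}, forall v, v \in U <-> P v.
Proof.
case=> P0 PD.
pose Q d := `[< exists2 U : {vspace V}, forall v, v \in U -> P v & \dim U = d >].
have Q0 : exists d, Q d.
  exists 0; apply/asboolP; exists 0%VS; last exact: dimv0.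
  by move=> v; rewrite memv0 => /eqP->.
have Qb d : Q d -> (d <= \dim {:V})%N.
  by move=> /asboolP[U _ <-]; rewrite dimvS ?subvf.
case: (ex_maxnP Q0 Qb) => d /asboolP[U UP dU] dmax.
exists U => v; split=> [/UP // | Pv].
have : Q (\dim (U + <[v]>)%VS).
  apply/asboolP; exists (U + <[v]>)%VS => // w /memv_addP[u /UP Pu].
  by case=> _ /vlineP[a ->] ->; rewrite addrC; apply: PD.
move/dmax; rewrite -dU => le_d.
have /eqP-> : U == (U + <[v]>)%VS by rewrite eqEdim addvSl.
by rewrite -{1}[v]add0r memv_add ?mem0v ?memv_line.
Qed.

Definition vspace_of (P : V -> Prop) (sP : subspace P) : {vspace V} :=
  sval (cid (vspace_of_ex sP)).

Lemma mem_vspace_of (P : V -> Prop) (sP : subspace P) v :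
  v \in vspace_of sP <-> P v.
Proof. by rewrite /vspace_of; case: cid. Qed.

End VspaceOf.

(* The quotient vector space V / U, on the carrier [Quotient.quot U] that
   MathComp only equips with a zmodType structure. *)

Section VspaceQuotient.
Import VectorInternalTheory.
Local Open Scope quotient_scope.
Variables (K : fieldType) (V : vectType K) (U : {vspace V}).

Definition vquot : Type := Quotient.quot U.

HB.instance Definition _ := GRing.Zmodule.on vquot.

Definition vquot_pi (v : V) : vquot := \pi_(Quotient.quot U) v.

Lemma vquot_pi_eq u v : (vquot_pi u = vquot_pi v) <-> (u - v \in U).
Proof.
rewrite (_ : (u - v \in U) = (u == v %[mod Quotient.quot U])).
  by split=> [h|/eqP h]; [apply/eqP|].
exact: Quotient.idealrBE.
Qed.

Lemma vquot_pi_surj (x : vquot) : exists v, x = vquot_pi v.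
Proof. by exists (repr (x : Quotient.quot U)); rewrite /vquot_pi reprK. Qed.

Lemma vquot_pi_zmod : zmod_morphism vquot_pi.
Proof. by move=> u v; rewrite /vquot_pi raddfB. Qed.

Definition vquot_scale (a : K) (x : vquot) : vquot :=
  vquot_pi (a *: repr (x : Quotient.quot U)).

Lemma vquot_scaleE a v : vquot_scale a (vquot_pi v) = vquot_pi (a *: v).
Proof.
apply/vquot_pi_eq; rewrite -scalerBr memvZ //.
by apply/vquot_pi_eq; rewrite /vquot_pi reprK.
Qed.

Lemma vquot_piD u v : vquot_pi (u + v) = vquot_pi u + vquot_pi v.
Proof. by rewrite /vquot_pi raddfD. Qed.

Lemma vquot_scaleA a b x :
  vquot_scale a (vquot_scale b x) = vquot_scale (a * b) x.
Proof. by case: (vquot_pi_surj x) => v ->; rewrite !vquot_scaleE scalerA. Qed.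

Lemma vquot_scale1 : left_id 1 vquot_scale.
Proof. by move=> x; case: (vquot_pi_surj x) => v ->; rewrite vquot_scaleE scale1r. Qed.

Lemma vquot_scaleDr : right_distributive vquot_scale +%R.
Proof.
move=> a x y; case: (vquot_pi_surj x) (vquot_pi_surj y) => u -> [v ->].
by rewrite -vquot_piD !vquot_scaleE scalerDr vquot_piD.
Qed.

Lemma vquot_scaleDl x : {morph vquot_scale^~ x : a b / a + b}.
Proof.
move=> a b; case: (vquot_pi_surj x) => u ->.
by rewrite !vquot_scaleE scalerDl vquot_piD.
Qed.

HB.instance Definition _ := GRing.Zmodule_isLmodule.Build K vquot
  vquot_scaleA vquot_scale1 vquot_scaleDr vquot_scaleDl.

Lemma vquot_pi_linear : linear vquot_pi.
Proof. by move=> a u v; rewrite vquot_piD -vquot_scaleE. Qed.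

HB.instance Definition _ := GRing.isLinear.Build K V vquot *:%R vquot_pi
  vquot_pi_linear.

(* Coordinates come from the complement of U, which maps bijectively onto V / U. *)
Lemma vquot_vect : Vector.axiom (dim (subvs_of (U^C)%VS)) vquot.
Proof.
pose h v : subvs_of (U^C)%VS := vsproj (U^C)%VS (v - projv U v).
have hE v : vsval (h v) = v - projv U v by rewrite vsprojK ?memv_projC.
have h_lin : linear h.
  move=> a u v; apply: subvs_inj; rewrite linearP /= !hE linearP /= scalerBr.
  by rewrite addrACA opprD.
have h0 v : v \in U -> h v = 0.
  by move=> vU; apply: subvs_inj; rewrite hE projv_id ?subrr.
have h_eq u v : u - v \in U -> h u = h v.
  by move=> /h0 huv; rewrite -[u](subrK v) -[u - v]scale1r h_lin huv scaler0 add0r.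
pose f (x : vquot) := v2r (h (repr (x : Quotient.quot U))).
have fE v : f (vquot_pi v) = v2r (h v).
  by congr v2r; apply/h_eq/vquot_pi_eq; rewrite /vquot_pi reprK.
exists f.
  move=> a x y; case: (vquot_pi_surj x) (vquot_pi_surj y) => u -> [v ->].
  by rewrite -linearP !fE h_lin linearP.
exists (fun r => vquot_pi (vsval (r2v r : subvs_of (U^C)%VS))).
  move=> x; case: (vquot_pi_surj x) => v ->; rewrite fE v2rK hE.
  by apply/vquot_pi_eq; rewrite addrAC subrr add0r memvN memv_proj.
move=> r; rewrite fE -[RHS]r2vK; congr v2r; apply: subvs_inj; rewrite hE.
have -> : projv U (vsval (r2v r : subvs_of (U^C)%VS)) = 0.
  apply/eqP; rewrite -memv_ker lker_proj; exact: subvsP.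
by rewrite subr0.
Qed.

HB.instance Definition _ := Lmodule_hasFinDim.Build K vquot vquot_vect.

End VspaceQuotient.

Section Products.
Variables (K : fieldType) (V V' W W' : vectType K).

Definition prod_fun (f : 'Hom(V, W)) (g : 'Hom(V', W')) (p : V * V') : W * W' :=
  (f p.1, g p.2).

Lemma prod_fun_linear f g : linear (prod_fun f g).
Proof. by move=> a p q; congr pair; rewrite /= linearP. Qed.

HB.instance Definition _ f g := GRing.isLinear.Build K (V * V')%type (W * W')%type
  *:%R (prod_fun f g) (prod_fun_linear f g).

Definition prod_lfun f g : 'Hom((V * V')%type, (W * W')%type) :=
  linfun (prod_fun f g).

Lemma prod_lfunE f g u v : prod_lfun f g (u, v) = (f u, g v).
Proof. by rewrite lfunE. Qed.

End Products.

(* R : V ~> V is a subspace of V x V, and v R w stands for (v, w) \in R. *)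
Notation linrel V := {vspace (V * V)%type}.

Section RelationOfMaps.
Variables (K : fieldType) (V W : vectType K).

Definition mapdiff (f g : 'Hom(V, W)) (p : V * V) : W := f p.1 - g p.2.

Lemma mapdiff_linear f g : linear (mapdiff f g).
Proof.
by move=> a p q; rewrite /mapdiff /= !linearP /= scalerBr scalerN addrACA.
Qed.

HB.instance Definition _ f g := GRing.isLinear.Build K (V * V)%type W
  *:%R (mapdiff f g) (mapdiff_linear f g).

Definition relmap (f g : 'Hom(V, W)) : linrel V := lker (linfun (mapdiff f g)).

Lemma mem_relmap f g v v' : ((v, v') \in relmap f g) = (f v == g v').
Proof. by rewrite memv_ker lfunE /= subr_eq0. Qed.

End RelationOfMaps.

Section Graph.
Variables (K : fieldType) (V : vectType K).

Definition graph (T : 'End(V)) : linrel V := relmap T \1%VF.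

Lemma mem_graph T v w : ((v, w) \in graph T) = (T v == w).
Proof. by rewrite mem_relmap id_lfunE. Qed.

End Graph.

Section Regularization.
Variables (K : fieldType) (V : vectType K) (R : linrel V).

Definition inD (v : V) : Prop :=
  exists2 u : int -> V, forall i : int, (u i, u (i + 1)) \in R & u 0 = v.

Definition inKp (v : V) : Prop :=
  exists k (u : nat -> V),
    [/\ u 0%N = v, forall i, (i < k)%N -> (u i, u i.+1) \in R & (u k, 0) \in R].

(* The chain v_{-k}, ..., v_0 is indexed from 0 to k. *)
Definition inKm (v : V) : Prop :=
  exists k (u : nat -> V),
    [/\ (0, u 0%N) \in R, forall i, (i < k)%N -> (u i, u i.+1) \in R & u k = v].

Lemma rel0 : (0 : V, 0 : V) \in R. Proof. exact: (mem0v R). Qed.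

Lemma relP a u u' v v' :
  (u, u') \in R -> (v, v') \in R -> (a *: u + v, a *: u' + v') \in R.
Proof. by move=> uR vR; exact: memvD (memvZ a uR) vR. Qed.

Lemma inD_subspace : subspace inD.
Proof.
split; first by exists (fun=> 0) => // i; apply: rel0.
move=> a _ _ [f fR <-] [g gR <-]; exists (fun i => a *: f i + g i) => // i.
exact: relP.
Qed.

(* Chains can be lengthened by zeros, since 0 R 0. *)
Lemma inKp_pad k l v (u : nat -> V) : (k <= l)%N ->
    u 0%N = v -> (forall i, (i < k)%N -> (u i, u i.+1) \in R) -> (u k, 0) \in R ->
  exists u' : nat -> V, 
    [/\ u' 0%N = v, forall i, (i < l)%N -> (u' i, u' i.+1) \in R & (u' l, 0) \in R].
Proof.
move=> le_kl u0 uR uk; exists (fun i => if (i <= k)%N then u i else 0).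
split=> // [i _|].
  case: (ltngtP i k) => [/uR // | | -> //]; first by rewrite rel0.
by case: (ltngtP l k) le_kl => // [_ | ->] _; rewrite ?rel0.
Qed.

Lemma inKp_subspace : subspace inKp.
Proof.
split; first by exists 0%N, (fun=> 0); split=> // *; apply: rel0.
move=> a _ _ [k [f [<- fR fk]]] [l [g [<- gR gl]]].
have [f' [<- f'R f'k]] := inKp_pad (leq_maxl k l) (erefl _) fR fk.
have [g' [<- g'R g'l]] := inKp_pad (leq_maxr k l) (erefl _) gR gl.
exists (maxn k l), (fun i => a *: f' i + g' i); split=> // [i lti|].
  by apply: relP; [apply: f'R | apply: g'R].
by rewrite -[X in (_, X)]addr0 -[X in (_, X + _)](scaler0 _ a); apply: relP.
Qed.

Lemma inKm_pad k l v (u : nat -> V) : (k <= l)%N ->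
    (0, u 0%N) \in R -> (forall i, (i < k)%N -> (u i, u i.+1) \in R) -> u k = v ->
  exists u' : nat -> V,
    [/\ (0, u' 0%N) \in R, forall i, (i < l)%N -> (u' i, u' i.+1) \in R & u' l = v].
Proof.
move=> le_kl u0 uR uk.
exists (fun i => if (l - k <= i)%N then u (i - (l - k))%N else 0); split=> [|i lti|].
- by case: ifP => _; rewrite ?rel0 // sub0n.
- case: (leqP (l - k) i) => [le_i | lt_i].
    rewrite (leq_trans le_i) // subSn //; apply: uR.
    by rewrite ltn_subLR // subnK.
  case: ifP => // le_i; last exact: rel0.
  by have -> : (i.+1 - (l - k) = 0)%N by apply/eqP; rewrite subn_eq0.
- by rewrite leq_subr subKn.
Qed.

Lemma inKm_subspace : subspace inKm.
Proof.
split; first by exists 0%N, (fun=> 0); split=> // *; apply: rel0.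
move=> a _ _ [k [f [f0 fR <-]]] [l [g [g0 gR <-]]].
have [f' [f'0 f'R <-]] := inKm_pad (leq_maxl k l) f0 fR (erefl _).
have [g' [g'0 g'R <-]] := inKm_pad (leq_maxr k l) g0 gR (erefl _).
exists (maxn k l), (fun i => a *: f' i + g' i); split=> // [|i lti].
  by rewrite -[X in (X, _)]addr0 -[X in (X + _, _)](scaler0 _ a); apply: relP.
by apply: relP; [apply: f'R | apply: g'R].
Qed.

Definition Dspace : {vspace V} := vspace_of inD_subspace.
Definition Kplus : {vspace V} := vspace_of inKp_subspace.
Definition Kminus : {vspace V} := vspace_of inKm_subspace.

Lemma mem_Dspace v : v \in Dspace <-> inD v. Proof. exact: mem_vspace_of. Qed.
Lemma mem_Kplus v : v \in Kplus <-> inKp v. Proof. exact: mem_vspace_of. Qed.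
Lemma mem_Kminus v : v \in Kminus <-> inKm v. Proof. exact: mem_vspace_of. Qed.

(* V_reg and R_reg are formed inside D, viewed as a space in its own right:
   Dnull and Drel are D :&: (K_+ + K_-) and R :&: (D x D) there. *)
Definition Dincl : 'Hom(subvs_of Dspace, V) := linfun vsval.

Definition Dnull : {vspace subvs_of Dspace} :=
  (Dincl @^-1: (Dspace :&: (Kplus + Kminus)))%VS.

Definition Vreg : vectType K := vquot Dnull.

Definition Dproj : 'Hom(subvs_of Dspace, Vreg) := linfun (@vquot_pi _ _ Dnull).

Definition Drel : linrel (subvs_of Dspace) := (prod_lfun Dincl Dincl @^-1: R)%VS.

Definition Rreg : linrel Vreg := (prod_lfun Dproj Dproj @: Drel)%VS.

Lemma DinclE d : Dincl d = vsval d. Proof. by rewrite lfunE. Qed.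

Lemma mem_Drel d e : ((d, e) \in Drel) = ((vsval d, vsval e) \in R).
Proof. by rewrite -memv_preim prod_lfunE !DinclE. Qed.

Lemma mem_Dnull d : (d \in Dnull) = (vsval d \in Kplus + Kminus)%VS.
Proof. by rewrite -memv_preim DinclE memv_cap subvsP. Qed.

Lemma Dproj_surj (x : Vreg) : exists d, x = Dproj d.
Proof. by case: (vquot_pi_surj x) => d ->; exists d; rewrite lfunE. Qed.

Lemma Dproj_eq0 d : (Dproj d == 0) = (d \in Dnull).
Proof.
rewrite lfunE /= -[d in RHS]subr0 -(linear0 (@vquot_pi _ _ Dnull)).
by apply/eqP/idP => /vquot_pi_eq.
Qed.

Lemma mem_Rreg x y :
  (x, y) \in Rreg <->
  exists d e, [/\ x = Dproj d, y = Dproj e & (vsval d, vsval e) \in R].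
Proof.
split=> [/memv_imgP[[d e]] | [d [e [-> -> deR]]]].
  by rewrite mem_Drel prod_lfunE => deR [-> ->]; exists d, e.
by apply/memv_imgP; exists (d, e); rewrite ?mem_Drel ?prod_lfunE.
Qed.

End Regularization.

Section GraphOfRelation.
Variables (K : fieldType) (V : vectType K).

Lemma graph_ex (G : linrel V) :
    (forall x, exists y, (x, y) \in G) -> (forall y, (0, y) \in G -> y = 0) ->
  exists T : 'End(V), graph T = G.
Proof.
move=> Gtot G0.
have Guniq x y y' : (x, y) \in G -> (x, y') \in G -> y = y'.
  move=> xy xy'; apply/eqP; rewrite -subr_eq0; apply/eqP/G0.
  by rewrite -[X in (X, _)](subrr x); apply: (memvB xy xy').
pose t x := sval (cid (Gtot x)).
have tP x : (x, t x) \in G by rewrite /t; case: cid.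
have t_lin : linear t.
  by move=> a x y; apply: Guniq (tP _) _; apply: relP.
pose tM := GRing.isLinear.Build _ _ _ _ t t_lin.
pose tL : {linear V -> V} := HB.pack t tM.
exists (linfun tL); apply/vspaceP=> -[x y]; rewrite mem_graph lfunE /=.
by apply/eqP/idP => [<- // | xy]; apply: Guniq (tP x) xy.
Qed.

Lemma graph_inj : injective (@graph K V).
Proof.
move=> S T eqST; apply/lfunP=> x; apply/eqP.
by rewrite -mem_graph eqST mem_graph.
Qed.

End GraphOfRelation.

Section RegularIso.
Variables (K : fieldType) (V : vectType K) (R : linrel V).

Lemma Dspace_next v :
  v \in Dspace R -> exists2 w, w \in Dspace R & (v, w) \in R.
Proof.
move=> /mem_Dspace[u uR <-]; exists (u 1); last exact: (uR 0).
by apply/mem_Dspace; exists (fun i => u (1 + i)) => [i|]; rewrite ?addrA // addr0.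
Qed.

Lemma Kplus_next v : v \in Kplus R -> exists2 w, w \in Kplus R & (v, w) \in R.
Proof.
move=> /mem_Kplus[[|k] [u [<- uR uk]]]; first by exists 0; rewrite ?mem0v.
exists (u 1%N); last exact: uR.
by apply/mem_Kplus; exists k, (u \o succn); split=> //= i ltik; apply: uR.
Qed.

Lemma Kplus_prev v w : w \in Kplus R -> (v, w) \in R -> v \in Kplus R.
Proof.
move=> /mem_Kplus[k [u [u0 uR uk]]] vw; apply/mem_Kplus.
exists k.+1, (fun i => if i is j.+1 then u j else v); split=> // -[|i] lti.
  by rewrite u0.
exact: uR.
Qed.

Lemma Kminus_prev w : w \in Kminus R -> exists2 v, v \in Kminus R & (v, w) \in R.
Proof.
move=> /mem_Kminus[[|k] [u [u0 uR <-]]]; first by exists 0; rewrite ?mem0v.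
exists (u k); last exact: uR.
by apply/mem_Kminus; exists k, u; split=> // i /ltnW; apply: uR.
Qed.

Lemma Kminus_next v w : v \in Kminus R -> (v, w) \in R -> w \in Kminus R.
Proof.
move=> /mem_Kminus[k [u [u0 uR uk]]] vw; apply/mem_Kminus.
exists k.+1, (fun i => if (i <= k)%N then u i else w).
split=> [|i|]; rewrite ?ltnn // ltnS => lei; rewrite lei.
by case: (ltngtP i k) lei => // [/uR // | ->] _; rewrite uk.
Qed.

Lemma Ksum_next v w :
  v \in (Kplus R + Kminus R)%VS -> (v, w) \in R -> w \in (Kplus R + Kminus R)%VS.
Proof.
move=> /memv_addP[a aK [b bK ->]] vw; have [a' a'K aa'] := Kplus_next aK.
rewrite -[w](subrK a') addrC memv_add // (Kminus_next bK) //.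
by rewrite -[b](addKr a) addrC; apply: memvB vw aa'.
Qed.

Lemma Ksum_prev v w :
  w \in (Kplus R + Kminus R)%VS -> (v, w) \in R -> v \in (Kplus R + Kminus R)%VS.
Proof.
move=> /memv_addP[a aK [b bK ->]] vw; have [b' b'K bb'] := Kminus_prev bK.
rewrite -[v](subrK b') memv_add // (Kplus_prev aK) //.
by rewrite -[a](addrK b); apply: memvB vw bb'.
Qed.

Lemma Rreg_graph : exists T : 'End(Vreg R), graph T = Rreg R /\ bijective T.
Proof.
have [|y|T TR] := @graph_ex _ _ (Rreg R).
- move=> x; have [d ->] := Dproj_surj x.
  have [w wD dw] := Dspace_next (subvsP d); exists (Dproj R (vsproj _ w)).
  by apply/mem_Rreg; exists d, (vsproj _ w); rewrite vsprojK.
- case/mem_Rreg => d [e [d0 -> de]]; apply/eqP.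
  rewrite Dproj_eq0 mem_Dnull (Ksum_next _ de) // -mem_Dnull -Dproj_eq0.
  exact/eqP/esym.
exists T; split=> //.
suff /eqP kerT : lker T == 0%VS.
  by exists (T^-1)%VF; [apply: lker0_lfunK | apply: lker0_lfunVK]; apply/eqP.
rewrite -subv0; apply/subvP=> x; rewrite memv_ker memv0 -mem_graph TR.
case/mem_Rreg => d [e [-> e0 de]].
rewrite Dproj_eq0 mem_Dnull (Ksum_prev _ de) // -mem_Dnull -Dproj_eq0.
exact/eqP/esym.
Qed.

(* The isomorphism T^R; it is unique by [graph_inj]. *)
Definition Treg : 'End(Vreg R) := sval (cid Rreg_graph).

Lemma graph_Treg : graph Treg = Rreg R.
Proof. by rewrite /Treg; case: cid => T []. Qed.

Lemma Treg_bij : bijective Treg.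
Proof. by rewrite /Treg; case: cid => T []. Qed.

End RegularIso.

Definition similar_rel (K : fieldType) (V V' : vectType K)
    (R : linrel V) (R' : linrel V') : Prop :=
  exists w : 'Hom(V, V'), bijective w /\ (prod_lfun w w @: R)%VS = R'.

Definition similar_end (K : fieldType) (V V' : vectType K)
    (T : 'End(V)) (T' : 'End(V')) : Prop :=
  exists w : 'Hom(V, V'), bijective w /\ (w \o T = T' \o w)%VF.

(* Matrices act on column vectors, so an m x n matrix is a map K^n -> K^m. *)
Definition mxlin (K : fieldType) m n (A : 'M[K]_(m, n)) : 'Hom('cV[K]_n, 'cV[K]_m) :=
  linfun (mulmx A).

Lemma mxlinE (K : fieldType) m n (A : 'M[K]_(m, n)) v : mxlin A v = A *m v.
Proof. by rewrite lfunE. Qed.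

Definition Rmx (K : fieldType) m n (A B : 'M[K]_(m, n)) : linrel 'cV[K]_n :=
  relmap (mxlin A) (mxlin B).

Lemma mem_Rmx (K : fieldType) m n (A B : 'M[K]_(m, n)) v v' :
  ((v, v') \in Rmx A B) = (A *m v == B *m v').
Proof. by rewrite mem_relmap !mxlinE. Qed.

Definition surjective (aT rT : Type) (f : aT -> rT) : Prop :=
  forall y, exists x, f x = y.

Section Modifications.
Variable K : fieldType.

Record mxpair : Type :=
  MxPair {nrows : nat; ncols : nat;
          mxA : 'M[K]_(nrows, ncols); mxB : 'M[K]_(nrows, ncols)}.

(* [T1 P P'] holds if P' is a value of T_1(P) for some choice of the matrices C
   and D, and similarly for T2 and T3. The row and column block sizes r + s and
   p + q are those forced by the ranks. In MathComp, [row_free] means full row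
   rank and [row_full] means full column rank. *)

Inductive T1 : mxpair -> mxpair -> Prop :=
| T1_value r s p q (A B : 'M[K]_(r + s, p + q))
    (C : 'M[K]_(r + s)) (A1 B1 : 'M[K]_(r, p + q)) (B2 : 'M[K]_(s, p + q))
    (D : 'M[K]_(p + q)) (A11 B11 : 'M[K]_(r, p)) (A12 B12 : 'M[K]_(r, q))
    (B21 : 'M[K]_(s, p)) of
    C \in unitmx & C *m A = col_mx A1 0 & row_free A1 & C *m B = col_mx B1 B2 &
    D \in unitmx & B2 *m D = row_mx B21 0 & row_full B21 &
    A1 *m D = row_mx A11 A12 & B1 *m D = row_mx B11 B12 :
  T1 (MxPair A B) (MxPair A12 B12).

Inductive T2 : mxpair -> mxpair -> Prop :=
| T2_value r s p q (A B : 'M[K]_(r + s, p + q))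
    (C : 'M[K]_(r + s)) (A1 B1 : 'M[K]_(r, p + q)) (A2 : 'M[K]_(s, p + q))
    (D : 'M[K]_(p + q)) (A11 B11 : 'M[K]_(r, p)) (A12 B12 : 'M[K]_(r, q))
    (A21 : 'M[K]_(s, p)) of
    C \in unitmx & C *m B = col_mx B1 0 & row_free B1 & C *m A = col_mx A1 A2 &
    D \in unitmx & A2 *m D = row_mx A21 0 & row_full A21 &
    A1 *m D = row_mx A11 A12 & B1 *m D = row_mx B11 B12 :
  T2 (MxPair A B) (MxPair A12 B12).

Inductive T3 : mxpair -> mxpair -> Prop :=
| T3_value r s p q (A B : 'M[K]_(r + s, p + q))
    (D : 'M[K]_(p + q)) (A1 B1 : 'M[K]_(r + s, p)) (B2 : 'M[K]_(r + s, q))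
    (C : 'M[K]_(r + s)) (B12 : 'M[K]_(r, q))
    (A11 B11 : 'M[K]_(r, p)) (A21 B21 : 'M[K]_(s, p)) of
    D \in unitmx & A *m D = row_mx A1 0 & row_full A1 & B *m D = row_mx B1 B2 &
    C \in unitmx & C *m B2 = col_mx B12 0 & row_free B12 &
    C *m A1 = col_mx A11 A21 & C *m B1 = col_mx B11 B21 :
  T3 (MxPair A B) (MxPair A21 B21).

(* The procedure, as a transition system: the choices made by T1, T2, T3 make
   it nondeterministic. *)

Inductive stage := StageI | StageII | StageIII | Stopped.

Definition config : Type := (stage * mxpair)%type.

Definition A_surjective (P : mxpair) : Prop := surjective (mxlin (mxA P)).
Definition B_surjective (P : mxpair) : Prop := surjective (mxlin (mxB P)).
Definition A_injective (P : mxpair) : Prop := injective (mxlin (mxA P)).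

Inductive step : config -> config -> Prop :=
| stepI_go P of A_surjective P : step (StageI, P) (StageII, P)
| stepI_T1 P P' of ~ A_surjective P & T1 P P' : step (StageI, P) (StageI, P')
| stepII_go P of B_surjective P : step (StageII, P) (StageIII, P)
| stepII_T2 P P' of ~ B_surjective P & T2 P P' : step (StageII, P) (StageII, P')
| stepIII_stop P of A_injective P : step (StageIII, P) (Stopped, P)
| stepIII_T3 P P' of ~ A_injective P & T3 P P' : step (StageIII, P) (StageIII, P').

Inductive reaches : config -> config -> Prop :=
| reaches_refl c : reaches c c
| reaches_step c c' c'' of step c c' & reaches c' c'' : reaches c c''.

(* Every run from c stops after finitely many steps, without getting stuck. *)
Inductive terminates : config -> Prop :=
| terminates_stopped P : terminates (Stopped, P)
| terminates_step c of (exists c', step c c') &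
    (forall c', step c c' -> terminates c') : terminates c.

Definition outputs (P Q : mxpair) : Prop := reaches (StageI, P) (Stopped, Q).

End Modifications.

(* Main.v *)
(** T1 and T2 restrict the relation R(A, B) to a subspace containing its range,
    respectively its domain; T3 divides out the kernel of A, whose vectors are all
    related to 0. In each case a linear map between the two spaces, the inclusion or
    the projection, carries one relation into the other, maps the spaces D onto each
    other and respects D :&: (K_+ + K_-), so R_reg is unchanged up to similarity.
    T1 and T2 drop a row, T3 drops a column, and T2, T3 keep the surjectivity won
    before, so the output is a pair of invertible matrices, whose relation is a graph. *)

Require Import Defs.
From mathcomp Require Import all_boot all_order all_algebra.
From mathcomp Require Import boolp.
Set Implicit Arguments.
Unset Strict Implicit.
Unset Printing Implicit Defensive.

Import GRing.Theory.
Local Open Scope ring_scope.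

(** * Bijectivity and factorization of linear maps *)

Section LinearMaps.
Variables (K : fieldType) (V W : vectType K).

Lemma lfun_bijective (f : 'Hom(V, W)) :
  (forall v, f v = 0 -> v = 0) -> surjective f -> bijective f.
Proof.
move=> f0 fS.
have kf : lker f == 0%VS.
  by rewrite -subv0; apply/subvP=> v; rewrite memv_ker memv0 => /eqP/f0->.
exists (f^-1)%VF; first exact: lker0_lfunK.
by move=> w; apply: limg_lfunVK; case: (fS w) => v <-; rewrite memv_img ?memvf.
Qed.

Lemma lfun_bij_inv (f : 'Hom(V, W)) :
  bijective f -> cancel f (f^-1)%VF /\ cancel (f^-1)%VF f.
Proof.
move=> fB; have kf : lker f == 0%VS by apply/lker0P/bij_inj.
split; first exact: lker0_lfunK.
case: fB => g _ gK w; apply: limg_lfunVK.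
by rewrite -[w]gK memv_img ?memvf.
Qed.

(** [p^-1] picks a preimage under [p]; it differs from [u] by an element of the kernel of [p], which
    [g] kills. *)
Lemma lfun_factor (U : vectType K) (p : 'Hom(U, V)) (g : 'Hom(U, W)) :
  surjective p -> (forall u, p u = 0 -> g u = 0) ->
  exists h : 'Hom(V, W), forall u, h (p u) = g u.
Proof.
move=> pS p0; exists (g \o p^-1)%VF => u; rewrite comp_lfunE.
apply/eqP; rewrite -subr_eq0 -linearB /=; apply/eqP/p0.
by rewrite linearB /= limg_lfunVK ?subrr // memv_img ?memvf.
Qed.

End LinearMaps.

(** * Similarity of linear relations *)

Section Similarity.
Variable K : fieldType.
Implicit Types V : vectType K.

Lemma similar_relP V V' (R : linrel V) (R' : linrel V') :
  similar_rel R R' <->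
  exists w : 'Hom(V, V'),
    bijective w /\ forall x y, ((w x, w y) \in R') = ((x, y) \in R).
Proof.
split=> -[w [wB wR]]; exists w; split=> //.
  move=> x y; rewrite -wR; apply/memv_imgP/idP.
    by case=> -[x' y'] xyR; rewrite prod_lfunE => -[/(bij_inj wB)-> /(bij_inj wB)->].
  by move=> xyR; exists (x, y); rewrite ?prod_lfunE.
apply/vspaceP=> -[x' y']; have [g wK gK] := wB.
apply/memv_imgP/idP => [[[x y] xyR]|].
  by rewrite prod_lfunE => ->; rewrite wR.
rewrite -[x']gK -[y']gK wR => gR.
by exists (g x', g y'); rewrite ?prod_lfunE.
Qed.

Lemma similar_rel_refl V (R : linrel V) : similar_rel R R.
Proof.
apply/similar_relP; exists \1%VF; split; last by move=> x y; rewrite !id_lfunE.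
by exists id => x; rewrite id_lfunE.
Qed.

Lemma similar_rel_sym V V' (R : linrel V) (R' : linrel V') :
  similar_rel R R' -> similar_rel R' R.
Proof.
move=> /similar_relP[w [wB wR]]; apply/similar_relP.
have [wK Kw] := lfun_bij_inv wB; exists (w^-1)%VF; split; first by exists w.
by move=> x y; rewrite -wR !Kw.
Qed.

Lemma similar_rel_trans V1 V2 V3 (R1 : linrel V1) (R2 : linrel V2) (R3 : linrel V3) :
  similar_rel R1 R2 -> similar_rel R2 R3 -> similar_rel R1 R3.
Proof.
move=> /similar_relP[f [fB fR]] /similar_relP[g [gB gR]]; apply/similar_relP.
exists (g \o f)%VF; split=> [|x y]; last by rewrite !comp_lfunE gR fR.
by apply: (eq_bij (bij_comp gB fB)) => x; rewrite comp_lfunE.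
Qed.

Lemma similar_graph V V' (T : 'End(V)) (T' : 'End(V')) :
  similar_rel (graph T) (graph T') -> similar_end T T'.
Proof.
move=> /similar_relP[w [wB wR]]; exists w; split=> //; apply/lfunP=> x.
by rewrite !comp_lfunE; apply/esym/eqP; rewrite -mem_graph wR mem_graph.
Qed.

End Similarity.

(** * Morphisms of relations and the induced map on V_reg *)

Section Morphisms.
Variables (K : fieldType) (V V' : vectType K) (R : linrel V) (R' : linrel V').
Variable f : 'Hom(V, V').
Hypothesis fR : forall v w, (v, w) \in R -> (f v, f w) \in R'.

Lemma Dspace_morph v : v \in Dspace R -> f v \in Dspace R'.
Proof.
move=> /mem_Dspace[u uR <-]; apply/mem_Dspace.
by exists (f \o u) => //= i; apply: fR.
Qed.

Lemma Kplus_morph v : v \in Kplus R -> f v \in Kplus R'.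
Proof.
move=> /mem_Kplus[k [u [<- uR uk]]]; apply/mem_Kplus.
exists k, (f \o u); split=> //= [i /uR/fR //|].
by rewrite -(linear0 f); apply: fR.
Qed.

Lemma Kminus_morph v : v \in Kminus R -> f v \in Kminus R'.
Proof.
move=> /mem_Kminus[k [u [u0 uR <-]]]; apply/mem_Kminus.
exists k, (f \o u); split=> //= [|i /uR/fR //].
by rewrite -[X in (X, _)](linear0 f); apply: fR.
Qed.

Lemma Ksum_morph v :
  v \in (Kplus R + Kminus R)%VS -> f v \in (Kplus R' + Kminus R')%VS.
Proof.
move=> /memv_addP[a aK [b bK ->]]; rewrite linearD memv_add //.
  exact: Kplus_morph.
exact: Kminus_morph.
Qed.

(** This hypothesis and the next make the induced map on V_reg surjective and injective,
    respectively. *)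
Hypothesis fD : forall v', v' \in Dspace R' -> exists2 v, v \in Dspace R & f v = v'.
Hypothesis fK : forall v, v \in Dspace R -> f v \in (Kplus R' + Kminus R')%VS ->
  v \in (Kplus R + Kminus R)%VS.

(* The induced map is a bijection carrying [Rreg R] into [Rreg R']; both being
   graphs, the inclusion is an equality. *)
Lemma similar_Rreg : similar_rel (Rreg R) (Rreg R').
Proof.
(* [vsproj] only retypes [f d] as an element of [Dspace R'], where it already lies. *)
pose g := (Dproj R' \o linfun (vsproj (Dspace R')) \o f \o Dincl R)%VF.
have gE d : g d = Dproj R' (vsproj (Dspace R') (f (vsval d))).
  by rewrite !comp_lfunE DinclE [linfun (vsproj _) _]lfunE.
have fdK (d : subvs_of (Dspace R)) : vsval (vsproj (Dspace R') (f (vsval d))) = f (vsval d).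
  by rewrite vsprojK // Dspace_morph ?subvsP.
have g0 d : (g d == 0) = (Dproj R d == 0).
  rewrite gE !Dproj_eq0 !mem_Dnull fdK.
  by apply/idP/idP; [apply/fK/subvsP | apply: Ksum_morph].
have [|d /eqP|w wE] := @lfun_factor _ _ _ _ (Dproj R) g.
- by move=> x; have [d ->] := Dproj_surj x; exists d.
- by rewrite -g0 => /eqP.
have wB : bijective w.
  apply: lfun_bijective => [x|y].
    have [d ->] := Dproj_surj x.
    by rewrite wE => /eqP; rewrite g0 => /eqP.
  have [e ->] := Dproj_surj y; have [v vD fv] := fD (subvsP e).
  exists (Dproj R (vsproj _ v)); rewrite wE gE vsprojK // fv.
  by congr (Dproj R' _); apply: subvs_inj; rewrite vsprojK ?subvsP.
have wR x y : (x, y) \in Rreg R -> (w x, w y) \in Rreg R'.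
  case/mem_Rreg=> d [e [-> -> deR]]; apply/mem_Rreg; rewrite !wE !gE.
  by do 2!eexists; split=> //; rewrite !fdK; apply: fR.
apply/similar_relP; exists w; split=> // x y; apply/idP/idP => [|/wR //].
rewrite -graph_Treg mem_graph => /eqP Twx.
have : (x, Treg R x) \in Rreg R by rewrite -graph_Treg mem_graph.
move=> /[dup] xR /wR; rewrite -graph_Treg mem_graph Twx => /eqP /(bij_inj wB) ->.
exact: xR.
Qed.

End Morphisms.

(** * Restriction to a subspace containing the domain or the range *)

Section Restriction.
Variables (K : fieldType) (V V' : vectType K) (R : linrel V) (R' : linrel V').
Variable f : 'Hom(V', V).
Hypothesis f0 : forall x, f x = 0 -> x = 0.
Hypothesis fR : forall x y, ((f x, f y) \in R) = ((x, y) \in R').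
(** The first case serves [T2], the second [T1]. *)
Hypothesis imR : (forall v w, (v, w) \in R -> v \in limg f) \/
                 (forall v w, (v, w) \in R -> w \in limg f).

Let g := (f^-1)%VF.

Let fK : cancel f g.
Proof.
apply: lker0_lfunK; rewrite -subv0; apply/subvP=> v.
by rewrite memv_ker memv0 => /eqP/f0->.
Qed.

Let gK v : v \in limg f -> f (g v) = v.
Proof. exact: limg_lfunVK. Qed.

Let gR v w : v \in limg f -> w \in limg f -> (v, w) \in R -> (g v, g w) \in R'.
Proof. by move=> /gK fv /gK fw; rewrite -fR fv fw. Qed.

(** The whole chain lies in the image of [f], so [g] transports it: in the first case every vertex
    has a successor, the last one having 0; in the second every vertex but [v] has a predecessor. *)
Let Kplus_preim v : v \in limg f -> v \in Kplus R -> g v \in Kplus R'.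
Proof.
move=> vf /mem_Kplus[k [u [u0 uR uk]]].
have uf i : (i <= k)%N -> u i \in limg f.
  case: imR => [im|im] lei.
    by case: (ltngtP i k) lei => // [/uR/im //|-> _]; apply: im uk.
  by case: i lei => [|i] lei; [rewrite u0 | apply: im (uR i lei)].
apply/mem_Kplus; exists k, (g \o u); split=> /= [|i lti|]; first by rewrite u0.
  by apply: gR (uR i lti); rewrite uf // ltnW.
by rewrite -(linear0 g); apply: gR uk; rewrite ?uf ?mem0v.
Qed.

Let Kminus_preim v : v \in limg f -> v \in Kminus R -> g v \in Kminus R'.
Proof.
move=> vf /mem_Kminus[k [u [u0 uR uk]]].
have uf i : (i <= k)%N -> u i \in limg f.
  case: imR => [im|im] lei.
    by case: (ltngtP i k) lei => // [/uR/im //|-> _]; rewrite uk.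
  by case: i lei => [|i] lei; [apply: im u0 | apply: im (uR i lei)].
apply/mem_Kminus; exists k, (g \o u); split=> /= [|i lti|]; last by rewrite uk.
  by rewrite -[X in (X, _)](linear0 g); apply: gR u0; rewrite ?uf ?mem0v.
by apply: gR (uR i lti); rewrite uf // ltnW.
Qed.

(** Elements of K_+ have a successor, those of K_- a predecessor. *)
Let Kplus_or_Kminus_im : (Kplus R <= limg f)%VS \/ (Kminus R <= limg f)%VS.
Proof.
case: imR => im; [left | right]; apply/subvP=> v.
  by case/Kplus_next => w _ /im.
by case/Kminus_prev => w _ /im.
Qed.

Lemma similar_Rreg_restriction : similar_rel (Rreg R) (Rreg R').
Proof.
apply/similar_rel_sym/(@similar_Rreg _ _ _ _ _ f) => [x y|v|x _].
- by rewrite fR.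
- move=> /mem_Dspace[u uR <-].
  have uf i : u i \in limg f.
    case: imR => im; first exact: im (uR i).
    by have := uR (i - 1); rewrite subrK => /im.
  exists (g (u 0)); last exact: gK.
  by apply/mem_Dspace; exists (g \o u) => //= i; apply: gR.
move=> /memv_addP[a aK [b bK abE]].
(* One summand lies in the image by [Kplus_or_Kminus_im]; then so does the other, because the sum is
   [f x]. *)
have /andP[af bf] : (a \in limg f) && (b \in limg f).
  have xf : a + b \in limg f by rewrite -abE memv_img ?memvf.
  case: Kplus_or_Kminus_im => /subvP im.
    by have af := im _ aK; rewrite af -(addKr a b) memvD ?memvN.
  by have bf := im _ bK; rewrite bf -(addrK b a) memvB.
rewrite -[x]fK abE linearD memv_add //; first exact: Kplus_preim.
exact: Kminus_preim.
Qed.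

End Restriction.

(** * Quotient by vectors related to 0 *)

Section Quotient.
Variables (K : fieldType) (V V' : vectType K) (R : linrel V) (R' : linrel V').
Variable f : 'Hom(V, V').
Hypothesis fS : surjective f.
Hypothesis f0 : forall v, f v = 0 -> (v, 0) \in R.
Hypothesis fR : forall v w, (v, w) \in R -> (f v, f w) \in R'.
(** Lifting starts from any prescribed [v] in the fibre, so chains can be lifted vertex by
    vertex. *)
Hypothesis fL : forall v y, (f v, y) \in R' -> exists2 w, (v, w) \in R & f w = y.

Let Kplus_lift v : f v \in Kplus R' -> v \in Kplus R.
Proof.
move=> /mem_Kplus[k [u [u0 uR uk]]].
elim: k v u u0 uR uk => [|k IHk] v u u0 uR uk.
  (* The lift [w] of the final 0 may be nonzero, but it lies in the kernel of [f] and is therefore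
     related to 0: the lifted chain is one step longer. *)
  have [w vw /f0 w0] : exists2 w, (v, w) \in R & f w = 0 by apply: fL; rewrite -u0.
  apply: Kplus_prev vw; apply: Kplus_prev w0; exact: mem0v.
have [w vw fw] : exists2 w, (v, w) \in R & f w = u 1%N.
  by apply: fL; rewrite -u0 uR.
apply: Kplus_prev vw; apply: (IHk w (u \o succn)) => //= i.
exact: (uR i.+1).
Qed.

Let Kminus_lift y : y \in Kminus R' -> exists2 v, v \in Kminus R & f v = y.
Proof.
have f_0 := linear0 f.
move=> /mem_Kminus[k [u [u0 uR]]]; elim: k y uR => [|k IHk] y uR <-.
  have [w w0 <-] : exists2 w, (0, w) \in R & f w = u 0%N by apply: fL; rewrite f_0.
  by exists w => //; apply: Kminus_next w0; apply: mem0v.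
have uRk i : (i < k)%N -> (u i, u i.+1) \in R' by move=> /ltnW; apply: uR.
have [v vK fv] := IHk _ uRk erefl.
have [w vw <-] : exists2 w, (v, w) \in R & f w = u k.+1 by apply: fL; rewrite fv uR.
by exists w => //; apply: Kminus_next vw.
Qed.

(* The successors of [v] depend only on [f v], so a two-sided chain in [R'] can
   be lifted one step at a time, each step independently of the others. *)
Let Dspace_lift y : y \in Dspace R' -> exists2 v, v \in Dspace R & f v = y.
Proof.
move=> /mem_Dspace[u uR <-].
have L i : exists w, f w = u i /\ forall v, f v = u (i - 1) -> (v, w) \in R.
  have [v0 fv0] := fS (u (i - 1)).
  have [w v0w fw] : exists2 w, (v0, w) \in R & f w = u i.
    by apply: fL; rewrite fv0; have := uR (i - 1); rewrite subrK.
  exists w; split=> // v fv.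
  (* Vectors of one fibre differ by a vector related to 0, so they have the same successors. *)
  have : (v - v0, 0) \in R by apply: f0; rewrite linearB /= fv fv0 subrr.
  move=> vR; rewrite -[v](subrK v0) -[w]add0r; exact: memvD vR v0w.
pose h i := sval (cid (L i)).
have hP i : f (h i) = u i /\ forall v, f v = u (i - 1) -> (v, h i) \in R.
  by rewrite /h; case: cid.
exists (h 0); last by case: (hP 0).
apply/mem_Dspace; exists h => // i.
by apply: (proj2 (hP _)); rewrite addrK; case: (hP i).
Qed.

(** Injectivity of the induced map: if [f v] is a + b, lift b to [v'] in K_-; then [f] sends
    [v - v'] to a, so [v - v'] is in K_+. *)
Lemma similar_Rreg_quotient : similar_rel (Rreg R) (Rreg R').
Proof.
apply: (similar_Rreg fR) => // v _ /memv_addP[a aK [b /Kminus_lift[v' v'K fv'] fv]].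
rewrite -[v](subrK v') memv_add // Kplus_lift // linearB /= fv fv' addrK.
exact: aK.
Qed.

End Quotient.

(** * The regular part of the graph of a bijection *)

Lemma similar_Rreg_graph (K : fieldType) (V : vectType K) (T : 'End(V)) :
  bijective T -> similar_rel (Rreg (graph T)) (graph T).
Proof.
case=> S TK SK; set R := graph T.
have RE v w : ((v, w) \in R) = (T v == w) by exact: mem_graph.
have D v : v \in Dspace R.
  apply/mem_Dspace.
  (* The orbit of [v]: powers of [T] forwards and of its inverse [S] backwards. [Negz n] is -(n+1),
     hence [n.+1] iterations. *)
  exists (fun i : int => match i with Posz n => iter n T v | Negz n => iter n.+1 S v end) => //.
  case=> [n|[|n]]; rewrite RE.
  - by rewrite addn1.
  - by rewrite /= SK.
  by rewrite subn1 /= SK.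
have Kp v : v \in Kplus R -> v = 0.
  have T0 w : (T w == 0) = (w == 0) by rewrite -(inj_eq (can_inj TK) w) linear0.
  move=> /mem_Kplus[k [u [<- uR]]]; rewrite RE T0 => /eqP.
  elim: k uR => // k IHk uR uk; apply: IHk => [i /ltnW|]; first exact: uR.
  by apply/eqP; rewrite -T0; have := uR k (ltnSn k); rewrite RE uk.
have Km v : v \in Kminus R -> v = 0.
  move=> /mem_Kminus[k [u [u0 uR <-]]]; elim: k uR => [_|k IHk uR].
    by move: u0; rewrite RE linear0 eq_sym => /eqP.
  have uk : u k = 0 by apply: IHk => i /ltnW; apply: uR.
  by have := uR k (ltnSn k); rewrite RE uk linear0 eq_sym => /eqP.
(* As D is the whole space and K_+, K_- are zero, this map onto V_reg is bijective. *)
pose w := (Dproj R \o linfun (vsproj (Dspace R)))%VF.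
have wE v : w v = Dproj R (vsproj (Dspace R) v) by rewrite comp_lfunE [linfun (vsproj _) _]lfunE.
have wB : bijective w.
  apply: lfun_bijective => [v|y].
    rewrite wE => /eqP; rewrite Dproj_eq0 mem_Dnull vsprojK //.
    by case/memv_addP=> a /Kp-> [b /Km-> ->]; rewrite addr0.
  have [d ->] := Dproj_surj y; exists (vsval d); rewrite wE.
  by congr (Dproj R _); apply: subvs_inj; rewrite vsprojK.
have wR x y : (x, y) \in R -> (w x, w y) \in Rreg R.
  by move=> xyR; apply/mem_Rreg; rewrite !wE; do 2!eexists; split=> //; rewrite !vsprojK.
apply/similar_rel_sym/similar_relP; exists w; split=> // x y; apply/idP/idP => [|/wR //].
(* Both relations are graphs, so the inclusion [wR] is an equality. *)
rewrite -graph_Treg mem_graph => /eqP Twx.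
have : (w x, w (T x)) \in Rreg R by apply: wR; rewrite RE.
by rewrite -graph_Treg mem_graph RE Twx => /eqP/(bij_inj wB)->.
Qed.

(** * Surjectivity, injectivity and echelon forms of matrices *)

Section Matrices.
Variable K : fieldType.

Lemma surjective_mxlin m n (A : 'M[K]_(m, n)) : surjective (mxlin A) <-> row_free A.
Proof.
split=> [AS|/row_freeP[B AB] y]; last by exists (B *m y); rewrite mxlinE mulmxA AB mul1mx.
apply: inj_row_free => v vA0; apply/rowP=> j.
(* Each basis vector is some [A *m x], so [v] pairs to zero with it. *)
have [x xE] := AS (delta_mx j 0); rewrite mxlinE in xE.
have : (v *m delta_mx j (0 : 'I_1)) 0 0 = 0 by rewrite -xE mulmxA vA0 mul0mx mxE.
by rewrite -colE !mxE.
Qed.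

Lemma injective_mxlin m n (A : 'M[K]_(m, n)) : injective (mxlin A) <-> row_full A.
Proof.
split=> [AI|Af u v]; last by rewrite !mxlinE; apply: row_full_inj.
rewrite /row_full -mxrank_tr; apply: inj_row_free => v vA0; apply: trmx_inj.
by rewrite trmx0; apply: AI; rewrite !mxlinE mulmx0 -[A]trmxK -trmx_mul vA0 trmx0.
Qed.

(** Inverting [col_ebase] in the rank factorization leaves [pid_mx r *m row_ebase], whose lower rows
    vanish. The size equation [e] lets users substitute [m] away, which trivializes the cast. *)
Lemma row_echelon m n (A : 'M[K]_(m, n)) :
  exists r s (e : m = (r + s)%N) (C : 'M_(r + s)) (A1 : 'M_(r, n)),
    [/\ C \in unitmx, C *m castmx (e, erefl n) A = col_mx A1 0 & row_free A1].
Proof.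
have H r s (B : 'M[K]_(r + s, n)) : \rank B = r ->
    exists (C : 'M_(r + s)) (A1 : 'M_(r, n)),
      [/\ C \in unitmx, C *m B = col_mx A1 0 & row_free A1].
  move=> Br; pose U : 'M_(r + s, n) := invmx (col_ebase B) *m B.
  have Cu : invmx (col_ebase B) \in unitmx by rewrite unitmx_inv col_ebase_unit.
  have UE : U = pid_mx r *m row_ebase B.
    by rewrite /U -{2}[B]mulmx_ebase Br -mulmxA mulKmx ?col_ebase_unit.
  have U0 : dsubmx U = 0.
    rewrite UE -mul_dsub_mx (_ : dsubmx _ = 0) ?mul0mx //.
    by apply/matrixP=> i j; rewrite !mxE /= ltnNge leq_addr andbF.
  have UB : U = col_mx (usubmx U) 0 by rewrite -[in LHS](vsubmxK U) U0.
  exists (invmx (col_ebase B)), (usubmx U); split=> //.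
  by rewrite /row_free -(rank_col_mx0 s) -UB eqmxMfull ?Br // row_full_unit.
have e : m = (\rank A + (m - \rank A))%N by rewrite subnKC ?rank_leq_row.
exists (\rank A), (m - \rank A)%N, e; apply: H.
by rewrite eqmx_cast.
Qed.

Lemma col_echelon m n (A : 'M[K]_(m, n)) :
  exists p q (e : n = (p + q)%N) (D : 'M_(p + q)) (A1 : 'M_(m, p)),
    [/\ D \in unitmx, castmx (erefl m, e) A *m D = row_mx A1 0 & row_full A1].
Proof.
have [p [q [e [C [A1 [Cu CA A1f]]]]]] := row_echelon A^T; subst n.
exists p, q, erefl, C^T, A1^T; rewrite unitmx_tr; split=> //.
  rewrite !castmx_id in CA *; apply: trmx_inj.
  by rewrite trmx_mul trmxK CA tr_row_mx trmxK trmx0.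
by rewrite /row_full mxrank_tr.
Qed.

End Matrices.

(** * The modifications and their effect on the relation *)

Section Steps.
Variable K : fieldType.
Implicit Types P Q : mxpair K.

Definition pair_rel P : linrel 'cV[K]_(ncols P) := Rmx (mxA P) (mxB P).

(** Swapping exchanges [T1] with [T2] and turns the relation into its converse, so facts about [T2]
    follow from those about [T1]. *)
Definition swap P : mxpair K := MxPair (mxB P) (mxA P).

Lemma swapK P : swap (swap P) = P. Proof. by case: P. Qed.

Lemma T1_swap P P' : T1 P P' -> T2 (swap P) (swap P').
Proof. by case=> *; apply: T2_value; eassumption. Qed.

Lemma T2_swap P P' : T2 P P' -> T1 (swap P) (swap P').
Proof. by case=> *; apply: T1_value; eassumption. Qed.

Lemma pair_rel_swap P v w : ((v, w) \in pair_rel (swap P)) = ((w, v) \in pair_rel P).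
Proof. by rewrite !mem_Rmx eq_sym. Qed.

Lemma T1_exists P : exists P', T1 P P'.
Proof.
case: P => m n A B.
have [r [s [e [C [A1 [Cu CA A1f]]]]]] := row_echelon A; subst m.
have [p [q [e [D [B21 [Du BD Bf]]]]]] := col_echelon (dsubmx (C *m B)); subst n.
rewrite !castmx_id in CA BD; eexists.
exact: (T1_value Cu CA A1f (esym (vsubmxK _)) Du BD Bf
  (esym (hsubmxK _)) (esym (hsubmxK _))).
Qed.

Lemma T2_exists P : exists P', T2 P P'.
Proof.
by have [P' /T1_swap] := T1_exists (swap P); rewrite swapK; exists (swap P').
Qed.

Lemma T3_exists P : exists P', T3 P P'.
Proof.
case: P => m n A B.
have [p [q [e [D [A1 [Du AD A1f]]]]]] := col_echelon A; subst n.
have [r [s [e [C [B12 [Cu CB Bf]]]]]] := row_echelon (rsubmx (B *m D)); subst m.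
rewrite !castmx_id in CB AD; eexists.
exact: (T3_value Du AD A1f (esym (hsubmxK _)) Cu CB Bf
  (esym (vsubmxK _)) (esym (vsubmxK _))).
Qed.

(** In coordinates w = D (x', t') the lower block of A v = B w reads 0 = [B21] x', that is x' = 0.
    So the range lies in the subspace x' = 0, on which the upper block is the relation of [A12] and
    [B12]. *)
Lemma T1_embedding P P' : T1 P P' ->
  exists f : 'Hom('cV_(ncols P'), 'cV_(ncols P)),
    [/\ forall x, f x = 0 -> x = 0,
        forall x y, ((f x, f y) \in pair_rel P) = ((x, y) \in pair_rel P') &
        forall v w, (v, w) \in pair_rel P -> w \in limg f].
Proof.
case=> r s p q A B C A1 B1 B2 D A11 B11 A12 B12 B21 Cu CA A1f CB Du BD Bf A1D B1D /=.
have eA x t : C *m (A *m (D *m col_mx x t)) = col_mx (A11 *m x + A12 *m t) 0.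
  by rewrite !mulmxA CA !mul_col_mx A1D !mul0mx mul_row_col.
have eB x t : C *m (B *m (D *m col_mx x t)) =
    col_mx (B11 *m x + B12 *m t) (B21 *m x).
  by rewrite !mulmxA CB !mul_col_mx B1D BD !mul_row_col mul0mx addr0.
have relE x t x' t' : ((D *m col_mx x t, D *m col_mx x' t') \in Rmx A B) =
    (A11 *m x + A12 *m t == B11 *m x' + B12 *m t') && (x' == 0).
  rewrite mem_Rmx -(inj_eq (can_inj (mulKmx Cu))) eA eB.
  apply/eqP/andP => [/eq_col_mx[-> /esym Bx']|[/eqP-> /eqP->]]; last by rewrite !mulmx0.
  by rewrite eqxx; split=> //; apply/eqP/(row_full_inj Bf); rewrite mulmx0.
have split_mx (w : 'cV_(p + q)) : w = D *m col_mx (usubmx (invmx D *m w)) (dsubmx (invmx D *m w)).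
  by rewrite vsubmxK mulKVmx.
pose f := mxlin (D *m col_mx (0 : 'M_(p, q)) 1%:M).
have fE x : f x = D *m col_mx 0 x by rewrite mxlinE -mulmxA mul_col_mx mul0mx mul1mx.
exists f; split=> [x|x y|v w].
- rewrite fE => /(congr1 (mulmx (invmx D))); rewrite mulKmx // mulmx0.
  by rewrite -[0 in RHS]col_mx0 => /eq_col_mx[].
- by rewrite !fE relE eqxx andbT !mulmx0 !add0r /pair_rel mem_Rmx.
rewrite /pair_rel /= (split_mx v) (split_mx w) relE => /andP[_ /eqP->].
by rewrite -fE memv_img ?memvf.
Qed.

(** [f] keeps the coordinate x of D (x, t). The relation splits into [A21] x = [B21] x' and an upper
    equation always solvable for t', since [B12] has full row rank. *)
Lemma T3_projection P P' : T3 P P' ->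
  exists f : 'Hom('cV_(ncols P), 'cV_(ncols P')),
    [/\ surjective f,
        forall v, f v = 0 -> (v, 0) \in pair_rel P,
        forall v w, (v, w) \in pair_rel P -> (f v, f w) \in pair_rel P' &
        forall v y, (f v, y) \in pair_rel P' ->
          exists2 w, (v, w) \in pair_rel P & f w = y].
Proof.
case=> r s p q A B D A1 B1 B2 C B12 A11 B11 A21 B21 Du AD A1f BD Cu CB Bf CA1 CB1 /=.
have eA x t : C *m (A *m (D *m col_mx x t)) = col_mx (A11 *m x) (A21 *m x).
  by rewrite [A *m _]mulmxA AD mul_row_col mul0mx addr0 mulmxA CA1 mul_col_mx.
have eB x t : C *m (B *m (D *m col_mx x t)) =
    col_mx (B11 *m x + B12 *m t) (B21 *m x).
  rewrite [B *m _]mulmxA BD mul_row_col mulmxDr !mulmxA CB CB1 !mul_col_mx.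
  by rewrite add_col_mx mul0mx addr0.
have relE x t x' t' : ((D *m col_mx x t, D *m col_mx x' t') \in Rmx A B) =
    (A11 *m x == B11 *m x' + B12 *m t') && (A21 *m x == B21 *m x').
  rewrite mem_Rmx -(inj_eq (can_inj (mulKmx Cu))) eA eB.
  by apply/eqP/andP => [/eq_col_mx[-> ->]|[/eqP-> /eqP->]].
have split_mx (w : 'cV_(p + q)) : exists x t, w = D *m col_mx x t.
  by exists (usubmx (invmx D *m w)), (dsubmx (invmx D *m w)); rewrite vsubmxK mulKVmx.
pose f := mxlin (row_mx 1%:M (0 : 'M_(p, q)) *m invmx D).
have fE x t : f (D *m col_mx x t) = x.
  by rewrite mxlinE -mulmxA mulKmx // mul_row_col mul1mx mul0mx addr0.
exists f; split=> [x|v|v w|v y].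
- by exists (D *m col_mx x 0); rewrite fE.
- have [x [t ->]] := split_mx v; rewrite fE => ->.
  by rewrite /pair_rel mem_Rmx /= -(inj_eq (can_inj (mulKmx Cu))) eA !mulmx0 col_mx0.
- have [x [t ->]] := split_mx v; have [x' [t' ->]] := split_mx w.
  by rewrite !fE /pair_rel /= relE mem_Rmx => /andP[].
have [x [t ->]] := split_mx v; rewrite fE /pair_rel /= mem_Rmx => Axy.
have [X BX] := row_freeP Bf.
(* [X] is a right inverse of [B12], so this choice of t' solves the upper equation. *)
exists (D *m col_mx y (X *m (A11 *m x - B11 *m y))); rewrite ?fE // relE Axy andbT.
by rewrite mulmxA BX mul1mx addrC subrK.
Qed.

Lemma T1_similar P P' : T1 P P' -> similar_rel (Rreg (pair_rel P)) (Rreg (pair_rel P')).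
Proof.
case/T1_embedding=> f [f0 fR fim].
by apply: (similar_Rreg_restriction f0 fR); right.
Qed.

Lemma T2_similar P P' : T2 P P' -> similar_rel (Rreg (pair_rel P)) (Rreg (pair_rel P')).
Proof.
case/T2_swap/T1_embedding=> f [f0 fR fim].
apply: (similar_Rreg_restriction f0) => [x y|].
  by rewrite -!pair_rel_swap fR.
by left=> v w; rewrite -pair_rel_swap; apply: fim.
Qed.

Lemma T3_similar P P' : T3 P P' -> similar_rel (Rreg (pair_rel P)) (Rreg (pair_rel P')).
Proof. by case/T3_projection=> f [fS f0 fR fL]; apply: similar_Rreg_quotient fL. Qed.

(** [s] rows are dropped; were [s] zero, [A] would have full row rank. *)
Lemma T1_size P P' : T1 P P' ->
  [/\ (nrows P' <= nrows P)%N, (ncols P' <= ncols P)%N &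
      ~ A_surjective P -> (nrows P' < nrows P)%N].
Proof.
case=> r s p q A B C A1 B1 B2 D A11 B11 A12 B12 B21 Cu CA A1f _ _ _ _ _ _ /=.
rewrite leq_addr leq_addl; split=> //; case: s => [|s] in A B C B2 B21 Cu CA *; last first.
  by move=> _; rewrite addnS ltnS leq_addr.
case; apply/surjective_mxlin; rewrite /row_free /=.
by rewrite -(mulKmx Cu A) eqmxMfull ?row_full_unit ?unitmx_inv // CA rank_col_mx0 addn0.
Qed.

Lemma T2_size P P' : T2 P P' ->
  [/\ (nrows P' <= nrows P)%N, (ncols P' <= ncols P)%N &
      ~ B_surjective P -> (nrows P' < nrows P)%N].
Proof. by move/T2_swap/T1_size. Qed.

(** [q] columns are dropped; were [q] zero, [A] would have full column rank. *)
Lemma T3_size P P' : T3 P P' ->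
  [/\ (nrows P' <= nrows P)%N, (ncols P' <= ncols P)%N &
      ~ A_injective P -> (ncols P' < ncols P)%N].
Proof.
case=> r s p q A B D A1 B1 B2 C B12 A11 B11 A21 B21 Du AD A1f _ _ _ _ _ _ /=.
rewrite leq_addr leq_addl; split=> //; case: q => [|q] in A B D B2 B12 Du AD *; last first.
  by move=> _; rewrite addnS ltnS leq_addr.
case; apply/injective_mxlin; rewrite /row_full /=.
rewrite -(mulmxK Du A) mxrankMfree ?row_free_unit ?unitmx_inv // AD rank_row_mx0.
by rewrite addn0.
Qed.

(** Solve [A] z = C^-1 (y, 0) with z = D (x, t): the lower block gives [A21] x = 0, so x = 0 and
    [A12] t = y. *)
Lemma T2_A_surjective P P' : T2 P P' -> A_surjective P -> A_surjective P'.
Proof.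
case=> r s p q A B C A1 B1 A2 D A11 B11 A12 B12 A21 Cu _ _ CA Du A2D A2f A1D _ /= AS y.
have [z] := AS (invmx C *m col_mx y 0); rewrite mxlinE /=.
rewrite -(mulKVmx Du z) -[invmx D *m z]vsubmxK; move: (usubmx _) (dsubmx _) => x t.
move/(congr1 (mulmx C)); rewrite mulKVmx // !mulmxA CA !mul_col_mx A1D A2D.
rewrite !mul_row_col mul0mx addr0 => /eq_col_mx[xt x0]; exists t; rewrite mxlinE /= -xt.
have -> : x = 0 by apply: (row_full_inj A2f); rewrite x0 mulmx0.
by rewrite mulmx0 add0r.
Qed.

(** The lower blocks of C A D and C B D are [A21] and [B21] followed by zeros, so a solution for (0,
    y) yields a preimage of y. *)
Lemma T3_surjective P P' : T3 P P' ->
  (A_surjective P -> A_surjective P') /\ (B_surjective P -> B_surjective P').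
Proof.
case=> r s p q A B D A1 B1 B2 C B12 A11 B11 A21 B21 Du AD _ BD Cu CB _ CA1 CB1.
split=> [AS | BS] y.
  have [z] := AS (invmx C *m col_mx 0 y); rewrite mxlinE /=.
  rewrite -(mulKVmx Du z) -[invmx D *m z]vsubmxK; move: (usubmx _) (dsubmx _) => x t.
  rewrite mulmxA AD mul_row_col mul0mx addr0 => /(congr1 (mulmx C)).
  rewrite mulKVmx // mulmxA CA1 mul_col_mx => /eq_col_mx[_ xy].
  by exists x; rewrite mxlinE.
have [z] := BS (invmx C *m col_mx 0 y); rewrite mxlinE /=.
rewrite -(mulKVmx Du z) -[invmx D *m z]vsubmxK; move: (usubmx _) (dsubmx _) => x t.
rewrite mulmxA BD mul_row_col => /(congr1 (mulmx C)).
rewrite mulKVmx // mulmxDr !mulmxA CB CB1 !mul_col_mx add_col_mx mul0mx addr0.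
by case/eq_col_mx=> _ xy; exists x; rewrite mxlinE.
Qed.

(** * Termination of the three loops *)

Lemma terminates_III P : terminates (StageIII, P).
Proof.
(* The measure is the number of columns in stage III, and of rows in stages I and II. *)
have [n le_Pn] := ubnP (ncols P); elim: n => // n IHn in P le_Pn *.
apply: terminates_step.
  have [AI|AI] := EM (A_injective P); first by exists (Stopped, P); apply: stepIII_stop.
  by have [P' PP'] := T3_exists P; exists (StageIII, P'); apply: stepIII_T3.
move=> c' st; inversion st as [| | | |P1 _|P1 P' AI PP']; first exact: terminates_stopped.
by apply: IHn; case: (T3_size PP') => _ _ /(_ AI) /leq_trans; apply.
Qed.

Lemma terminates_II P : terminates (StageII, P).
Proof.
have [n le_Pn] := ubnP (nrows P); elim: n => // n IHn in P le_Pn *.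
apply: terminates_step.
  have [BS|BS] := EM (B_surjective P); first by exists (StageIII, P); apply: stepII_go.
  by have [P' PP'] := T2_exists P; exists (StageII, P'); apply: stepII_T2.
move=> c' st; inversion st as [| |P1 _|P1 P' BS PP'| |]; first exact: terminates_III.
by apply: IHn; case: (T2_size PP') => _ _ /(_ BS) /leq_trans; apply.
Qed.

Lemma terminates_I P : terminates (StageI, P).
Proof.
have [n le_Pn] := ubnP (nrows P); elim: n => // n IHn in P le_Pn *.
apply: terminates_step.
  have [AS|AS] := EM (A_surjective P); first by exists (StageII, P); apply: stepI_go.
  by have [P' PP'] := T1_exists P; exists (StageI, P'); apply: stepI_T1.
move=> c' st; inversion st as [P1 _|P1 P' AS PP'| | | |]; first exact: terminates_II.
by apply: IHn; case: (T1_size PP') => _ _ /(_ AS) /leq_trans; apply.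
Qed.

(** * Invariants along a run: surjectivity already won, similarity class, size bounds *)

Definition stage_inv (c : config K) : Prop :=
  match c.1 with
  | StageI => True
  | StageII => A_surjective c.2
  | StageIII => A_surjective c.2 /\ B_surjective c.2
  | Stopped => [/\ A_surjective c.2, B_surjective c.2 & A_injective c.2]
  end.

Lemma step_inv c c' : step c c' -> stage_inv c -> stage_inv c'.
Proof.
case=> {c c'} [P AS _|//|P BS AS|P P' _ PP'|P AI [AS BS]|P P' _ PP' [AS BS]] //.
  exact: T2_A_surjective.
by have [hA hB] := T3_surjective PP'; split; [apply: hA | apply: hB].
Qed.

Lemma step_reg c c' : step c c' ->
  [/\ similar_rel (Rreg (pair_rel c.2)) (Rreg (pair_rel c'.2)),
      (nrows c'.2 <= nrows c.2)%N & (ncols c'.2 <= ncols c.2)%N].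
Proof.
case=> {c c'} [P _|P P' _ PP'|P _|P P' _ PP'|P _|P P' _ PP'] /=.
all: try by split=> //; apply: similar_rel_refl.
- by have [? ? _] := T1_size PP'; split=> //; apply: T1_similar.
- by have [? ? _] := T2_size PP'; split=> //; apply: T2_similar.
- by have [? ? _] := T3_size PP'; split=> //; apply: T3_similar.
Qed.

Lemma reaches_inv c c' : reaches c c' -> stage_inv c ->
  [/\ stage_inv c', similar_rel (Rreg (pair_rel c.2)) (Rreg (pair_rel c'.2)),
      (nrows c'.2 <= nrows c.2)%N & (ncols c'.2 <= ncols c.2)%N].
Proof.
elim=> {c c'} [c ci | c c' c'' cc' _ IH ci]; first by split=> //; apply: similar_rel_refl.
have [i2 s2 r2 n2] := IH (step_inv cc' ci); have [s1 r1 n1] := step_reg cc'.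
split=> //; first exact: similar_rel_trans s1 s2.
  exact: leq_trans r2 r1.
exact: leq_trans n2 n1.
Qed.

End Steps.

(** * The output pair *)

Lemma Rmx_graph (K : fieldType) k (A B : 'M[K]_k) :
  B \in unitmx -> Rmx A B = graph (mxlin (invmx B *m A)).
Proof.
move=> Bu; apply/vspaceP=> -[v w]; rewrite mem_Rmx mem_graph mxlinE -mulmxA.
by rewrite -(inj_eq (can_inj (mulKmx Bu)) _ w) mulKVmx.
Qed.

Theorem mainTheorem3 (K : fieldType) (m n : nat) (A B : 'M[K]_(m, n)) :
  terminates (StageI, MxPair A B) /\
  forall Q : mxpair K, outputs (MxPair A B) Q ->
    exists (k : nat) (A' B' : 'M[K]_k),
      Q = MxPair A' B' /\ (k <= minn m n)%N /\
      A' \in unitmx /\ B' \in unitmx /\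
      similar_rel (Rreg (Rmx A B)) (Rreg (Rmx A' B')) /\
      similar_end (Treg (Rmx A B)) (mxlin (invmx B' *m A')).
Proof.
split=> [|Q /reaches_inv/(_ I)[]]; first exact: terminates_I.
case: Q => m' n' A' B' /= [/surjective_mxlin /= Af /surjective_mxlin /= Bf].
move=> /injective_mxlin /= Ai simR le_m le_n.
(* The rank of [A'] equals its row count by surjectivity and its column count by injectivity. *)
have e : m' = n' by rewrite -(eqP Af) (eqP Ai).
subst n'; have Au : A' \in unitmx by rewrite -row_free_unit.
have Bu : B' \in unitmx by rewrite -row_free_unit.
exists m', A', B'; rewrite leq_min le_m le_n; do 5!split=> //.
(* The graph of T^R is R_reg, similar to the regular part of the output relation, which is itself
   similar to the graph of B'^-1 A'. *)
apply: similar_graph; rewrite graph_Treg; apply: similar_rel_trans simR _.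
rewrite /pair_rel /= Rmx_graph //; apply: similar_Rreg_graph.
by exists (mxlin (invmx A' *m B')) => v; rewrite !mxlinE !mulmxA mulmxK // mulVmx // mul1mx.
Qed.
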